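(* Let $A,B$ be logically independent events. The set $\Pi$ of all coherent assessments $(x,y,z,\mu)$ on the family $\mathcal F=\{A,\,B,\,AB,\,B|A\}$ (where $x=P(A)$, $y=P(B)$, $z=P(AB)$, $\mu=P(B|A)$) is $\Pi=\Pi'\cup\Pi''$, where $$\Pi'=\{(x,y,z,\mu): x\in(0,1],\ y\in[0,1],\ z\in[z',z''],\ \mu=\tfrac{z}{x}\},\qquad z'=\max\{x+y-1,0\},\quad z''=\min\{x,y\},$$ and $$\Pi''=\{(0,y,0,\mu): (y,\mu)\in[0,1]^2\}.$$
   Context: Events are elements of a Boolean algebra with sure event $\Omega$ and impossible event $\emptyset$; $\overline{E}$ is negation, $EF$ is conjunction, and an event is identified with its $0/1$ indicator. $A,B$ are logically independent if $AB,\ A\overline B,\ \overline AB,\ \overline A\,\overline B$ are all $\neq\emptyset$. An unconditional event $E$ is identified with $E|\Omega$. Coherence (de Finetti). A real assessment $(p_1,\dots,p_n)$ on a finite family of conditional events $\{E_1|H_1,\dots,E_n|H_n\}$ ($H_i\neq\emptyset$) is coherent if for every nonempty $S\subseteq\{1,\dots,n\}$ and all real $s_i$ ($i\in S$), the set $D$ of values of the random gain $G=\sum_{i\in S}s_iH_i(E_i-p_i)$ on the constituents (nonimpossible atoms generated by the $E_i,H_i$) contained in $\bigvee_{i\in S}H_i$ satisfies $\min D\le0\le\max D$. *)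

(* Defs.v *)
From mathcomp Require Import all_boot all_order all_algebra.
From mathcomp Require Import classical_sets reals.

Set Implicit Arguments.
Unset Strict Implicit.
Unset Printing Implicit Defensive.

Import Order.TTheory GRing.Theory Num.Theory.
Local Open Scope ring_scope.

Section Events.
(* A Boolean algebra of events: \top is the sure event, \bot the impossible
   one, ~` negation, `&` conjunction, and C <= E means that C implies E. *)
Context {d : Order.disp_t} {T : ctbDistrLatticeType d}.

Definition logically_independent (A B : T) : Prop :=
  [/\ A `&` B != \bot, A `&` ~` B != \bot,
      ~` A `&` B != \bot & ~` A `&` ~` B != \bot]%O.

Record cond_event := CondEvent {
  ce_event : T;
  ce_hyp : T;
  ce_hyp_neq0 : ce_hyp != \bot%O }.

Definition literal (b : bool) (E : T) : T := if b then E else (~` E)%O.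

Definition atom n (F : n.-tuple cond_event)
    (e : {ffun 'I_n -> bool * bool}) : T :=
  (\meet_(i < n) (literal (e i).1 (ce_event (tnth F i)) `&`
                  literal (e i).2 (ce_hyp (tnth F i))))%O.

Definition constituents n (F : n.-tuple cond_event) : seq T :=
  [seq C <- codom (atom F) | C != \bot%O].

(* Each ce_event and ce_hyp of the family is either implied by, or incompatible
   with, a given constituent C, so on C the 0/1 indicator of E is (C <= E). *)
Definition indicator (R : realType) (C E : T) : R := (C <= E)%O%:R.

Definition gain (R : realType) n (F : n.-tuple cond_event) (p : n.-tuple R)
    (S : {set 'I_n}) (s : 'I_n -> R) (C : T) : R :=
  \sum_(i in S) s i * indicator R C (ce_hyp (tnth F i)) *
    (indicator R C (ce_event (tnth F i)) - tnth p i).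

Definition gain_values (R : realType) n (F : n.-tuple cond_event)
    (p : n.-tuple R) (S : {set 'I_n}) (s : 'I_n -> R) : seq R :=
  [seq gain F p S s C | C <- constituents F &
     (C <= \join_(i in S) ce_hyp (tnth F i))%O].

Definition is_min (R : realType) (D : seq R) (m : R) : Prop :=
  m \in D /\ {in D, forall v, m <= v}.

Definition is_max (R : realType) (D : seq R) (m : R) : Prop :=
  m \in D /\ {in D, forall v, v <= m}.

Definition coherent (R : realType) n (F : n.-tuple cond_event)
    (p : n.-tuple R) : Prop :=
  forall (S : {set 'I_n}) (s : 'I_n -> R), S != finset.set0 ->
    exists m M, [/\ is_min (gain_values F p S s) m,
                    is_max (gain_values F p S s) M & m <= 0 <= M].

Lemma neq0_top (A : T) : A != \bot%O -> (\top : T)%O != \bot%O.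
Proof. by apply: contra_neq => t0; apply/eqP; rewrite -lex0 -t0 lex1. Qed.

Lemma logically_independent_neq0 (A B : T) :
  logically_independent A B -> A != \bot%O.
Proof. by case=> + _ _ _; apply: contra_neq => ->; rewrite meet0x. Qed.

Definition cond_family (A B : T) (AB : logically_independent A B) :
    4.-tuple cond_event :=
  let A0 := logically_independent_neq0 AB in
  let uncond E := CondEvent E (neq0_top A0) in
  [tuple uncond A; uncond B; uncond (A `&` B)%O; CondEvent B A0].

End Events.

Arguments cond_event {d} T.

Definition Pi' (R : realType) : set (R * R * R * R) :=
  [set q | let: (x, y, z, mu) := q in
    [/\ x \in `]0, 1], y \in `[0, 1],
        z \in `[Num.max (x + y - 1) 0, Num.min x y] & mu = z / x]%R]%classic.

Definition Pi'' (R : realType) : set (R * R * R * R) :=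
  [set q | let: (x, y, z, mu) := q in
    [/\ x = 0, z = 0, y \in `[0, 1] & mu \in `[0, 1]]%R]%classic.

(* Main.v *)
(* The constituents of the family are the four cells determined by A and B.
   Coherence asks that, for all stakes, some cell gives a nonnegative gain
   (changing the sign of the stakes gives the other bound), both for bets on the
   whole family and for bets on B|A alone, the latter being restricted to A.
   Suitable stakes make the gain constant or of constant sign, which yields the
   Frechet bounds and z = mu * x.  Conversely, under these constraints the
   cells get the probabilities z, x - z, y - z, 1 - x - y + z, for which every
   gain has mean 0. *)
Require Import Defs.
From mathcomp Require Import all_boot all_order all_algebra.
From mathcomp Require Import classical_sets reals.
From mathcomp Require Import ring lra.

Set Implicit Arguments.
Unset Strict Implicit.
Unset Printing Implicit Defensive.

Import Order.CTheory Order.TTheory GRing.Theory Num.Theory.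
Local Open Scope ring_scope.

(** * Constituents of the family as cells of [A] and [B] *)

Section Constituents.
Context {d : Order.disp_t} {T : ctbDistrLatticeType d}.
Implicit Types (A B C E : T) (a b : bool).
Local Open Scope order_scope.

Definition cell A B a b : T := literal a A `&` literal b B.

(** On a nonimpossible [C] this gives [E] a definite truth value, which the 0/1 indicator then reads
    correctly. *)
Definition decides C E : bool := (C <= E) || (C <= ~` E).

Lemma le_literal b C E : C != \bot -> decides C E ->
  (C <= literal b E) = (b == (C <= E)).
Proof.
move=> C0 /orP dCE.
have nboth : ~~ ((C <= E) && (C <= ~` E)).
  by apply: contra C0; rewrite -lexI meetxC lex0.
case: b dCE nboth => /=; first by case: (C <= E).
by case: (C <= E) => /= [_ /negbTE -> | [//|->]].
Qed.

Lemma decidesI C E E' : decides C E -> decides C E' -> decides C (E `&` E').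
Proof.
rewrite /decides complI lexI => /orP[->|CE] /orP[->|CE'] //=.
- by rewrite orbC (le_trans CE') ?leUr.
- by rewrite orbC (le_trans CE) ?leUl.
- by rewrite orbC (le_trans CE) ?leUl.
Qed.

Lemma decides1 C : decides C \top.
Proof. by rewrite /decides lex1. Qed.

Lemma cell_decidesl A B a b : decides (cell A B a b) A.
Proof. by rewrite /decides /cell; case: a; rewrite /= leIl ?orbT. Qed.

Lemma cell_decidesr A B a b : decides (cell A B a b) B.
Proof. by rewrite /decides /cell; case: b; rewrite /= leIr ?orbT. Qed.

Lemma atom_le n (F : n.-tuple (cond_event T)) e i :
  atom F e <= literal (e i).1 (ce_event (tnth F i)) `&`
              literal (e i).2 (ce_hyp (tnth F i)).
Proof. by rewrite /atom (bigD1 i) //= leIl. Qed.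

Section Family.
Variables (A B : T) (AB : logically_independent A B).
Let F := cond_family AB.

Lemma cell_neq0 a b : cell A B a b != \bot.
Proof. by case: AB; rewrite /cell; case: a; case: b. Qed.

Lemma cell_le_l a b : (cell A B a b <= A) = a.
Proof.
have := le_literal a (cell_neq0 a b) (cell_decidesl A B a b).
by rewrite leIl; move/esym/eqP.
Qed.

Lemma cell_le_r a b : (cell A B a b <= B) = b.
Proof.
have := le_literal b (cell_neq0 a b) (cell_decidesr A B a b).
by rewrite leIr; move/esym/eqP.
Qed.

Lemma cell_decides_family a b i :
  decides (cell A B a b) (ce_event (tnth F i)) /\
  decides (cell A B a b) (ce_hyp (tnth F i)).
Proof.
have dA := cell_decidesl A B a b; have dB := cell_decidesr A B a b.
case: i => -[|[|[|[|//]]]] i; rewrite (tnth_nth (tnth F ord0)) /=;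
  by split=> //; first [exact: decides1 | exact: decidesI].
Qed.

Lemma event0 : ce_event (tnth F (inord 0)) = A.
Proof. by rewrite (tnth_nth (tnth F ord0)) inordK. Qed.

Lemma event1 : ce_event (tnth F (inord 1)) = B.
Proof. by rewrite (tnth_nth (tnth F ord0)) inordK. Qed.

Lemma atom_le_cell e :
  atom F e <= cell A B (e (inord 0)).1 (e (inord 1)).1.
Proof.
have h i : atom F e <= literal (e i).1 (ce_event (tnth F i)).
  exact: le_trans (atom_le F e i) (leIl _ _).
by rewrite /cell lexI -{1}event0 -{1}event1 !h.
Qed.

(** An atom fixes the signs of [A] and [B], so it lies below one cell. A cell already decides every
    event and hypothesis of the family, so a nonimpossible atom below it cannot be strictly
    smaller. *)
Lemma mem_constituents C :
  reflect (exists a b, C = cell A B a b) (C \in constituents F).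
Proof.
rewrite mem_filter; apply: (iffP andP) => [[C0 /codomP[e eC]]|[a [b ->]]].
  exists (e (inord 0)).1, (e (inord 1)).1.
  set c := cell _ _ _ _.
  have Cc : C <= c by rewrite eC; exact: atom_le_cell.
  (* As [C] is nonimpossible and below [c], both give [E] the same truth value. *)
  have tight b E : decides c E -> C <= literal b E -> c <= literal b E.
    move=> dcE; have dCE : decides C E.
      by case/orP: dcE => /(le_trans Cc) h; rewrite /decides h ?orbT.
    rewrite !le_literal ?cell_neq0 // => /eqP ->; apply/eqP.
    case/orP: dcE => h; first by rewrite h (le_trans Cc h).
    have := le_literal false C0 dCE; rewrite /= (le_trans Cc h).
    have := le_literal false (cell_neq0 _ _) (introT orP (or_intror h)).
    by rewrite /= h => /esym/eqP <- /esym/eqP <-.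
  apply: le_anti; rewrite Cc {1}eC /=; apply/meetsP => i _.
  have [dE dH] := cell_decides_family (e (inord 0)).1 (e (inord 1)).1 i.
  have := atom_le F e i; rewrite -eC lexI => /andP[hE hH].
  by rewrite lexI !tight.
split; first exact: cell_neq0.
set c := cell A B a b.
(* The signs of the wanted atom are the truth values taken on the cell. *)
have [e eE] : exists e : {ffun 'I_4 -> bool * bool}, forall i,
    e i = (c <= ce_event (tnth F i), c <= ce_hyp (tnth F i)).
  by eexists [ffun i => _] => i; rewrite ffunE.
apply/codomP; exists e; apply: le_anti; apply/andP; split.
  apply/meetsP => i _; have [dE dH] := cell_decides_family a b i.
  by rewrite lexI !le_literal ?cell_neq0 // eE /= !eqxx.
by have := atom_le_cell e; rewrite !eE event0 event1 cell_le_l cell_le_r.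
Qed.

(** Only the last member, [B|A], has a hypothesis other than the sure event, so the join is [\top]
    unless that member stands alone. *)
Lemma cell_le_hyps (S : {set 'I_4}) a b :
  S != finset.set0 ->
  (cell A B a b <= \join_(i in S) ce_hyp (tnth F i)) =
    a || (S != [set ord_max]%SET).
Proof.
move=> S0; have [->|S3] /= := eqVneq S [set ord_max]%SET.
  by rewrite big_set1 (tnth_nth (tnth F ord0)) /= cell_le_l orbF.
have [i iS i3] : exists2 i, i \in S & i != ord_max.
  apply/exists_inP; apply: contraR S3; rewrite negb_exists_in => /forall_inP h.
  have sub : S \subset [set ord_max]%SET.
    by apply/fintype.subsetP=> i /h; rewrite negbK inE.
  by move: sub; rewrite subset1 (negbTE S0) orbF.
rewrite orbT (bigD1 i) //=; apply: le_trans (leUl _ _).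
case: i i3 {iS} => -[|[|[|[|//]]]] i //= _;
  by rewrite (tnth_nth (tnth F ord0)) /= lex1.
Qed.

End Family.
End Constituents.

(** * Coherence as inequalities on cell gains *)

Section Coherence.
Context {R : realType} {d : Order.disp_t} {T : ctbDistrLatticeType d}.

Lemma seq_has_min (D : seq R) v : v \in D -> exists m, is_min D m.
Proof.
elim: D v => // u [_ _ _|w D IH _ _].
  by exists u; split=> [|v]; rewrite !inE // => /eqP ->.
have [m [mD mP]] := IH w (mem_head _ _).
have [um|/ltW mu] := leP u m.
  exists u; split=> [|v]; first exact: mem_head.
  by rewrite inE => /orP[/eqP -> //|/mP]; apply: le_trans.
by exists m; split=> [|v]; rewrite inE ?mD ?orbT // => /orP[/eqP ->|/mP].
Qed.

Lemma seq_has_max (D : seq R) v : v \in D -> exists m, is_max D m.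
Proof.
move=> vD; have [m [/mapP[u uD ->] mP]] := seq_has_min (map_f -%R vD).
by exists u; split=> // w /(map_f -%R) /mP; rewrite lerN2.
Qed.

Lemma gainN n (F : n.-tuple (cond_event T)) (p : n.-tuple R) S s C :
  gain F p S (fun i => - s i) C = - gain F p S s C.
Proof. by rewrite /gain -sumrN; apply: eq_bigr => i _; rewrite !mulNr. Qed.

(** Negating the stakes negates the gain, so the bound on the minimum is the bound on the maximum
    for the opposite stakes. A value in the list also ensures that both extrema exist. *)
Lemma coherent_gain_ge0 n (F : n.-tuple (cond_event T)) (p : n.-tuple R) :
  coherent F p <->
  forall S s, S != finset.set0 ->
    exists2 v, v \in gain_values F p S s & 0 <= v.
Proof.
split=> [coh S s /(coh S s)[_ [M [_ [MD _] /andP[_ M0]]]]|h S s S0].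
  by exists M.
have [v vD v0] := h S s S0.
have [_ /mapP[C CF ->]] := h S (fun i => - s i) S0.
rewrite gainN oppr_ge0 => C0.
have [m mP] := seq_has_min vD; have [M MP] := seq_has_max vD.
exists m, M; split=> //; apply/andP; split.
  exact: le_trans (mP.2 _ (map_f _ CF)) C0.
exact: le_trans v0 (MP.2 _ vD).
Qed.

Variables (A B : T) (AB : logically_independent A B).

(** The factor [a%:R] in the last term calls off the bet on [B|A] when [A] fails. *)
Definition cell_gain (x y z mu s1 s2 s3 s4 : R) (a b : bool) : R :=
  s1 * (a%:R - x) + s2 * (b%:R - y) + s3 * ((a && b)%:R - z)
    + s4 * a%:R * (b%:R - mu).

Lemma sum_ord4 (f : 'I_4 -> R) : \sum_i f i =
  f (inord 0) + f (inord 1) + f (inord 2) + f (inord 3).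
Proof.
have ordE k (i : 'I_4) : i = k :> nat -> f i = f (inord k).
  by move=> <-; rewrite inord_val.
rewrite !big_ord_recl big_ord0 addr0 !addrA.
by congr (_ + _ + _ + _); apply: ordE.
Qed.

(** Leaving a member out of [S] amounts to giving it stake 0. *)
Lemma gain_cell (x y z mu : R) (S : {set 'I_4}) (s : 'I_4 -> R) (a b : bool) :
  let s' i := if inord i \in S then s (inord i) else 0 in
  gain (cond_family AB) [tuple x; y; z; mu] S s (cell A B a b) =
  cell_gain x y z mu (s' 0%N) (s' 1%N) (s' 2%N) (s' 3%N) a b.
Proof.
rewrite /gain /cell_gain big_mkcond /= sum_ord4.
have e0 : cond_event T := tnth (cond_family AB) ord0.
rewrite !(tnth_nth e0) !(tnth_nth 0) !inordK //=.
rewrite /indicator lexI !lex1 !(cell_le_l AB) !(cell_le_r AB) !mulr1.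
by do 4 case: ifP => _; rewrite ?mul0r.
Qed.

(** Any [S] other than the singleton of [B|A] allows all four cells, so it is the full family with
    some stakes 0. The singleton allows only the cells inside [A], whence the second condition. *)
Lemma coherent_cond_family (x y z mu : R) :
  coherent (cond_family AB) [tuple x; y; z; mu] <->
  (forall s1 s2 s3 s4, exists a b, 0 <= cell_gain x y z mu s1 s2 s3 s4 a b) /\
  (forall s, exists b : bool, 0 <= s * (b%:R - mu)).
Proof.
have ord3 : inord 3 = ord_max :> 'I_4.
  by apply: val_inj; rewrite /= inordK.
have in3 k : (k < 3)%N -> (inord k \in [set (ord_max : 'I_4)]%SET) = false.
  move=> k3; rewrite inE -(inj_eq val_inj) /= inordK ?ltn_eqF //.
  exact: ltn_trans k3 _.
have T0 : [set: 'I_4]%SET != finset.set0 by apply/set0Pn; exists ord0.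
have M0 : [set (ord_max : 'I_4)]%SET != finset.set0.
  by apply/set0Pn; exists ord_max; rewrite inE.
rewrite coherent_gain_ge0; split=> [h|[hall hcond] S s S0].
  split=> [s1 s2 s3 s4|s].
    have [_ /mapP[C + ->]] := h [set: _]%SET (fun i => nth 0 [:: s1; s2; s3; s4] i) T0.
    rewrite mem_filter => /andP[_ /mem_constituents[a [b ->]]].
    by rewrite gain_cell !finset.in_setT !inordK //= => g0; exists a, b.
  have [_ /mapP[C + ->]] := h [set ord_max]%SET (fun=> s) M0.
  rewrite mem_filter => /andP[+ /mem_constituents[a [b eC]]].
  rewrite {}eC cell_le_hyps // eqxx orbF => a1.
  rewrite gain_cell ord3 set11 !in3 // /cell_gain a1 => g0.
  by exists b; move: g0; rewrite !mul0r !add0r mulr1.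
suff [a [b [hab g0]]] : exists a b, a || (S != [set ord_max]%SET) /\
    0 <= gain (cond_family AB) [tuple x; y; z; mu] S s (cell A B a b).
  eexists; last exact: g0.
  apply: map_f; rewrite mem_filter cell_le_hyps // hab.
  by apply/mem_constituents; exists a, b.
have [S3|S3] := eqVneq S [set ord_max]%SET.
  have [b g0] := hcond (s ord_max); exists true, b; split=> //.
  rewrite gain_cell S3 ord3 set11 !in3 // /cell_gain.
  by rewrite !mul0r !add0r mulr1.
pose s' i := if inord i \in S then s (inord i) else 0.
have [a [b g0]] := hall (s' 0%N) (s' 1%N) (s' 2%N) (s' 3%N).
by exists a, b; rewrite orbT gain_cell.
Qed.

(** * Solving the inequalities *)

Lemma cell_gains_ge0P x y z mu :
  (forall s1 s2 s3 s4, exists a b, 0 <= cell_gain x y z mu s1 s2 s3 s4 a b) <->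
  [/\ Num.max (x + y - 1) 0 <= z, z <= Num.min x y & z = mu * x].
Proof.
rewrite ge_max le_min; split=> [h|[/andP[xyz z0] /andP[zx zy] zmu] s1 s2 s3 s4].
  have g : forall s1 s2 s3 s4 c,
      (forall a b, cell_gain x y z mu s1 s2 s3 s4 a b <= c) -> 0 <= c.
    move=> s1 s2 s3 s4 c hc; have [a [b]] := h s1 s2 s3 s4.
    by move=> g0; exact: le_trans g0 (hc a b).
  (* The first four choices bet against one cell each: the gain is [c] minus the indicator of that
     cell, where [c] is the probability it should receive. The last two make the gain constant,
     equal to [mu * x - z] and its opposite. *)
  have h1 := g 1 1 (-1) 0 (1 - x - y + z).
  have h2 := g 0 0 (-1) 0 z.
  have h3 := g (-1) 0 1 0 (x - z).
  have h4 := g 0 (-1) 1 0 (y - z).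
  have h5 := g (- mu) 0 1 (-1) (mu * x - z).
  have h6 := g mu 0 (-1) 1 (z - mu * x).
  have {}h1 : 0 <= 1 - x - y + z by apply: h1 => -[] []; rewrite /cell_gain /=; lra.
  have {}h2 : 0 <= z by apply: h2 => -[] []; rewrite /cell_gain /=; lra.
  have {}h3 : 0 <= x - z by apply: h3 => -[] []; rewrite /cell_gain /=; lra.
  have {}h4 : 0 <= y - z by apply: h4 => -[] []; rewrite /cell_gain /=; lra.
  have {}h5 : 0 <= mu * x - z by apply: h5 => -[] []; rewrite /cell_gain /=; lra.
  have {}h6 : 0 <= z - mu * x by apply: h6 => -[] []; rewrite /cell_gain /=; lra.
  by split; [apply/andP; split|apply/andP; split|]; lra.
set g := cell_gain x y z mu s1 s2 s3 s4.
(* These weights have marginals [x], [y], [z]; the term in [s4] averages to a multiple of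
   [z - mu * x], which vanishes. *)
have mean0 : z * g true true + (x - z) * g true false + (y - z) * g false true
    + (1 - x - y + z) * g false false = 0.
  by rewrite /g /cell_gain /= zmu; ring.
have [h|/existsPn h] := boolP [exists a, exists b, 0 <= g a b].
  by have /existsP[a /existsP[b]] := h; exists a, b.
(* If all gains are negative, mean 0 forces every nonnegative weight to vanish, although the weights
   sum to 1. *)
have g0 a b : g a b < 0 by have /existsPn/(_ b) := h a; rewrite -ltNge.
have w00 : 0 <= 1 - x - y + z by lra.
have neg w a b : 0 <= w -> w * g a b <= 0.
  by move=> w0; rewrite mulr_ge0_le0 // ltW.
have null w a b : w * g a b = 0 -> w = 0.
  by move/eqP; rewrite mulf_eq0 (lt_eqF (g0 a b)) orbF => /eqP.
have n11 := neg z true true z0.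
have n10 : (x - z) * g true false <= 0 by apply: neg; lra.
have n01 : (y - z) * g false true <= 0 by apply: neg; lra.
have n00 := neg _ false false w00.
have e11 : z = 0 by apply: (null _ true true); lra.
have e10 : x - z = 0 by apply: (null _ true false); lra.
have e01 : y - z = 0 by apply: (null _ false true); lra.
have e00 : 1 - x - y + z = 0 by apply: (null _ false false); lra.
by exfalso; lra.
Qed.

(** Stake 1 bounds [mu] above by 1 and stake -1 bounds it below by 0; conversely the sign of the
    stake selects [b]. *)
Lemma cond_gains_ge0P (mu : R) :
  (forall s, exists b : bool, 0 <= s * (b%:R - mu)) <-> 0 <= mu <= 1.
Proof.
split=> [h|/andP[mu0 mu1] s].
  have [b1 h1] := h 1; have [b2 h2] := h (-1).
  by apply/andP; split; move: b1 b2 h1 h2 => [] []; rewrite /=; lra.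
have [s0|/ltW s0] := leP 0 s.
  by exists true; rewrite mulr_ge0 // subr_ge0.
by exists false; rewrite mulr_le0 // sub0r oppr_le0.
Qed.

End Coherence.

Theorem theorem5 (R : realType) (d : Order.disp_t) (T : ctbDistrLatticeType d)
    (A B : T) (AB : logically_independent A B) :
  ([set q : R * R * R * R | let: (x, y, z, mu) := q in
      coherent (cond_family AB) [tuple x; y; z; mu]] = @Pi' R `|` @Pi'' R)%classic.
Proof.
apply/seteqP; split=> -[[[x y] z] mu] /=.
  move=> /coherent_cond_family[/cell_gains_ge0P[]].
  rewrite ge_max le_min => /andP[xyz z0] /andP[zx zy] zmu.
  move=> /cond_gains_ge0P muI.
  (* At [x = 0] the relation [z = mu * x] only gives [z = 0] and [mu] stays free; otherwise it
     determines [mu]. *)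
  have [x0|x0] := eqVneq x 0.
    by right; rewrite x0 mulr0 in zmu; split=> //; rewrite in_itv /=; lra.
  left; split; rewrite ?in_itv /= ?ge_max ?le_min.
  - by rewrite lt_def x0; lra.
  - by lra.
  - by rewrite xyz z0 zx zy.
  - by rewrite zmu mulfK.
move=> q; apply/coherent_cond_family; rewrite cell_gains_ge0P cond_gains_ge0P.
case: q => -[].
  rewrite !in_itv /= => /andP[x0 x1] /andP[y0 y1] /andP[z1 z2] ->.
  (* These two bounds place [z / x] in the unit interval. *)
  have [zx0 zx] : 0 <= z /\ z <= x.
    by move: z1 z2; rewrite ge_max le_min => /andP[_ ->] /andP[->].
  rewrite divfK ?gt_eqF // divr_ge0 ?(ltW x0) // ler_pdivrMr // mul1r zx.
  by split.
move=> -> ->; rewrite !in_itv /= => /andP[y0 y1] ->.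
by rewrite mulr0 ge_max le_min lexx y0 add0r subr_le0 y1.
Qed.
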